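(* Let $1<p\le n$. Let $\mathbf{X}$ be a deterministic $n\times p$ matrix with $\mathbf{X}^T\mathbf{X}=\mathbf{I}_p$, let $\boldsymbol\beta_0=(\beta_1,0,\dots,0)^T\in\mathbb{R}^p$ with $\beta_1\neq 0$, let $\sigma>0$, and let $\mathbf{y}=\mathbf{X}\boldsymbol\beta_0+\boldsymbol\varepsilon$ with $\varepsilon_1,\dots,\varepsilon_n$ i.i.d. $N(0,\sigma^2)$. Set $\mathbf z=\mathbf{X}^T\mathbf{y}$. For $\lambda\ge 0$ define $$L_p(\lambda)=\frac1n\Big(\beta_1-\operatorname{sgn}(z_1)(|z_1|-\lambda)_+\Big)^2+\frac1n\sum_{j=2}^p\big((|z_j|-\lambda)_+\big)^2,\qquad L_1(\lambda)=\frac1n\Big(\beta_1-\operatorname{sgn}(z_1)(|z_1|-\lambda)_+\Big)^2,$$ and $L_p(\lambda_p^* )=\min_{\lambda\ge0}L_p(\lambda)$, $L_1(\lambda_1^* )=\min_{\lambda\ge 0}L_1(\lambda)$. Then $$\Pr\Big(L_p(\lambda_p^* )>L_1(\lambda_1^* )\ \Big|\ \operatorname{sgn}(z_1)=\operatorname{sgn}(\beta_1)\Big)=1-\frac{1}{2p\,\Phi\!\left(\frac{|\beta_1|}{\sigma}\right)},$$ where $\Phi$ is the standard normal cumulative distribution function. (The paper writes the event as $L_p(\lambda_p^* )/L_1(\lambda_1^* )>1$.)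
   Context: $(a)_+=\max(a,0)$; $\operatorname{sgn}$ is the sign function. $L_p(\lambda)$ is the $L_2$ loss of the Lasso estimate $\hat\beta_{\lambda j}=\operatorname{sgn}(z_j)(|z_j|-\lambda)_+$ with all $p$ predictors and $L_1(\lambda)$ the loss using only the first (true) predictor. *)

(* Defs.v *)
From HB Require Import structures.
From mathcomp Require Import all_boot all_order all_algebra.
From mathcomp Require Import all_classical all_reals all_analysis.
Set Implicit Arguments. Unset Strict Implicit. Unset Printing Implicit Defensive.
Import Order.TTheory GRing.Theory Num.Theory.
Local Open Scope classical_set_scope.
Local Open Scope ring_scope.

Definition pospart {R : realType} (a : R) : R := Num.max a 0.

Definition Phi {R : realType} (x : R) : R :=
  fine (normal_prob (0:R) 1 `]-oo, x]).

(* L_p(lambda): z is X^T y, i0 the index of the first (true) predictor *)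
Definition Lp {R : realType} (n p : nat) (i0 : 'I_p) (beta1 : R) (z : 'cV[R]_p)
  (lam : R) : R :=
  (n%:R)^-1 * (beta1 - Num.sg (z i0 0) * pospart (`|z i0 0| - lam)) ^+ 2
  + (n%:R)^-1 * \sum_(j < p | j != i0) (pospart (`|z j 0| - lam)) ^+ 2.

Definition L1 {R : realType} (n p : nat) (i0 : 'I_p) (beta1 : R) (z : 'cV[R]_p)
  (lam : R) : R :=
  (n%:R)^-1 * (beta1 - Num.sg (z i0 0) * pospart (`|z i0 0| - lam)) ^+ 2.

Definition mutually_independent {d} {T : measurableType d} {R : realType}
  (P : probability T R) (n : nat) (X : 'I_n -> T -> R) : Prop :=
  forall (J : {set 'I_n}) (B : 'I_n -> set R),
    (forall i, measurable (B i)) ->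
    P (\bigcap_(i in [set i | i \in J]) (X i @^-1` B i))
    = (\prod_(i in J) P (X i @^-1` B i))%E.

Definition cond_prob {d} {T : measurableType d} {R : realType}
  (P : probability T R) (A B : set T) : R :=
  fine (P (A `&` B)) / fine (P B).

(* Main.v *)
Require Import Defs.
From HB Require Import structures.
From mathcomp Require Import all_boot all_order all_algebra.
From mathcomp Require Import all_classical all_reals all_analysis.
From mathcomp Require Import measurable_realfun.
From mathcomp Require Import ring lra.
Set Implicit Arguments.
Unset Strict Implicit.
Unset Printing Implicit Defensive.
Import Order.TTheory GRing.Theory Num.Theory.
Import numFieldNormedType.Exports.
Local Open Scope classical_set_scope.
Local Open Scope ring_scope.
Set SsrOldRewriteGoalsOrder.

(** Put W_k = <x_k, eps>, with x_k the k-th column of X, and s = sgn beta1. When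
    sgn z_1 = s, the unique minimiser of L_1 is m = max(|z_1| - |beta1|, 0), where
    |z_1| - |beta1| = s W_1, so min L_p = min L_1 iff |W_k| <= max(s W_1, 0) for
    every k > 1. The law of eps is invariant under Householder reflections, and
    these carry x_1 to any (+/-) x_j while permuting the remaining columns up to
    sign; hence the 2p events "(+/-) W_j > |W_k| for all k <> j" have the same
    probability. They are disjoint and cover everything up to the null event of
    ties, so each has probability 1/(2p).
    Invariance under a reflection of a coordinate plane comes from writing that
    reflection as a product of shears and a flip, which preserve Lebesgue measure;
    an arbitrary reflection is a conjugate of plane ones. *)

(** Bundles the image measure with the measurability proof it depends on, so that uniqueness results
    for measures apply to it. *)
Definition pushforward_measure d1 d2 (T1 : measurableType d1)
    (T2 : measurableType d2) (R : realFieldType)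
    (m : {measure set T1 -> \bar R}) (f : T1 -> T2)
    (mf : measurable_fun setT f) : {measure set T2 -> \bar R} :=
  measure_function_pushforward__canonical__measure_function_Measure m mf.

(** * Lebesgue measure under affine maps of the line *)

Section lebesgue_affine.
Context {R : realType}.
Local Notation mu := (@lebesgue_measure R).

Lemma measurable_affine (a t : R) :
  measurable_fun setT (fun x : measurableTypeR R => a * x + t : measurableTypeR R).
Proof. by apply: measurable_funD => //; exact: measurable_funM. Qed.

(** The right-hand side is a measure in [A] that gives each half-open interval its length, which
    determines Lebesgue measure. *)
Lemma lebesgue_measure_affine (a : R) (a0 : 0 < a) t (A : set R) : measurable A ->
  mu A = (a%:E * mu ((fun x => a * x + t)%R @^-1` A))%E.
Proof.
move=> mA.
have -> : (a%:E * mu ((fun x => a * x + t)%R @^-1` A))%E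
  = mscale (NngNum (ltW a0)) (pushforward_measure mu (measurable_affine a t)) A by [].
apply: lebesgue_measure_unique => //= _ [[x y]] _ <-.
rewrite /mscale /pushforward_measure/= /pushforward/=.
have -> : (fun z => a * z + t) @^-1` `]x, y] = `](x - t) / a, (y - t) / a]%classic :> set R.
  apply/seteqP; split => z /=; rewrite !in_itv/= ltr_pdivrMr// ler_pdivlMr//.
    by move=> /andP[? ?]; apply/andP; split; lra.
  by move=> /andP[? ?]; apply/andP; split; lra.
rewrite !lebesgue_measure_itv/= !lte_fin ltr_pM2r ?invr_gt0// ltrD2r.
case: ifPn => _; last by rewrite mule0.
by rewrite -!EFinB -EFinM; congr EFin; field; rewrite gt_eqF.
Qed.

End lebesgue_affine.

(** * Area-preserving maps of the plane *)

Section area.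
Context {R : realType}.
Local Notation mu := (@lebesgue_measure R).
Local Notation R2 := (measurableTypeR R * measurableTypeR R)%type.
Local Open Scope ereal_scope.

(** The two orders of integration agree on rectangles. This lets a shear be studied through
    whichever sections it translates. *)
Lemma product_measure12
    (m : {sigma_finite_measure set (measurableTypeR R) -> \bar R}) (A : set R2) :
  measurable A -> (m \x m) A = (m \x^ m) A.
Proof.
by move=> mA; apply: product_measure_unique => //= B C mB mC; exact: product_measure2E.
Qed.

Definition area_preserving (g : R2 -> R2) :=
  measurable_fun setT g /\
  forall A, measurable A -> (mu \x mu) (g @^-1` A) = (mu \x mu) A.

Lemma area_preserving_comp f g : area_preserving f -> area_preserving g ->
  area_preserving (f \o g).
Proof.
move=> [mf af] [mg ag]; split; first exact: measurableT_comp.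
move=> A mA; rewrite comp_preimage ag ?af//.
by rewrite -[X in measurable X]setTI; exact: mf.
Qed.

(** At fixed height [y] the shear translates the horizontal section by [t * y]; integrating the
    section lengths over [y] gives the area. *)
Lemma area_preserving_shear1 (t : R) :
  area_preserving (fun x => (x.1 + t * x.2, x.2)%R).
Proof.
have mg : measurable_fun setT (fun x : R2 => (x.1 + t * x.2, x.2)%R : R2).
  apply/measurable_fun_pair => //=.
  by apply: measurable_funD => //; exact: measurable_funM.
split => // A mA.
have mgA : measurable ((fun x : R2 => (x.1 + t * x.2, x.2)%R : R2) @^-1` A).
  by rewrite -[X in measurable X]setTI; exact: mg.
rewrite !product_measure12//.
apply: eq_integral => y _ /=.
rewrite (lebesgue_measure_affine ltr01 (t * y)%R (measurable_ysection y mA)) mul1e.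
congr (mu _); apply/seteqP; split => x /=; rewrite /ysection/= !inE/= ?mul1r//.
Qed.

Lemma area_preserving_shear2 (t : R) :
  area_preserving (fun x => (x.1, x.2 + t * x.1)%R).
Proof.
have mg : measurable_fun setT (fun x : R2 => (x.1, x.2 + t * x.1)%R : R2).
  apply/measurable_fun_pair => //=.
  by apply: measurable_funD => //; exact: measurable_funM.
split => // A mA.
apply: eq_integral => y _ /=.
rewrite (lebesgue_measure_affine ltr01 (t * y)%R (measurable_xsection y mA)) mul1e.
congr (mu _); apply/seteqP; split => x /=; rewrite /xsection/= !inE/= ?mul1r//.
Qed.

Lemma area_preserving_opp2 : area_preserving (fun x => (x.1, - x.2)%R).
Proof.
have mg : measurable_fun setT (fun x : R2 => (x.1, - x.2)%R : R2).
  by apply/measurable_fun_pair => //=; apply: measurable_funN.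
split => // A mA.
apply: eq_integral => y _ /=.
rewrite -(@lebesgue_measureN _ (xsection A y)); last exact: measurable_xsection.
congr (mu _); apply/seteqP; split => x /=; rewrite /xsection/= !inE/= ?mul1r//.
Qed.

(** The orthogonal reflection with normal vector [(a, b)]. *)
Definition reflect2 (a b : R) (x : R2) : R2 :=
  let c := (2 * (a * x.1 + b * x.2) / (a ^+ 2 + b ^+ 2))%R in
  (x.1 - c * a, x.2 - c * b)%R.

Lemma area_preserving_reflect2 (a b : R) : b != 0%R ->
  area_preserving (reflect2 a b).
Proof.
move=> b0.
(* The reflection after the flip is a rotation, hence a product of three shears: for its angle
   [theta], [s] is the sine of [theta] and [a / b] is minus the tangent of [theta / 2]. *)
set s := (- 2 * a * b / (a ^+ 2 + b ^+ 2))%R.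
have -> : reflect2 a b =
  (fun x => (x.1 + a / b * x.2, x.2)%R) \o (fun x => (x.1, x.2 + s * x.1)%R) \o
  (fun x => (x.1 + a / b * x.2, x.2)%R) \o (fun x => (x.1, - x.2)%R).
  have r0 : (a ^+ 2 + b ^+ 2 != 0)%R.
    by rewrite gt_eqF// ltr_wpDl ?sqr_ge0// exprn_even_gt0.
  apply/funext => -[x y]; rewrite /reflect2 /s/=; congr pair; field; exact/andP.
by do !apply: area_preserving_comp;
  [exact: area_preserving_shear1|exact: area_preserving_shear2|
   exact: area_preserving_shear1|exact: area_preserving_opp2].
Qed.

End area.

(** * Measures given by a nonnegative density *)

Section density.
Local Open Scope ereal_scope.
Context d (T : measurableType d) (R : realType) (mu : {measure set T -> \bar R}).
Variables (f : T -> \bar R) (mf : measurable_fun setT f) (f0 : forall x, 0 <= f x).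

Definition density_measure (A : set T) := \int[mu]_(x in A) f x.

Let nu0 : density_measure set0 = 0.
Proof. by rewrite /density_measure integral_set0. Qed.

Let nu_ge0 A : 0 <= density_measure A.
Proof. exact: integral_ge0. Qed.

Let nu_sigma_additive : semi_sigma_additive density_measure.
Proof. exact: semi_sigma_additive_nng_induced. Qed.

Definition density : {measure set T -> \bar R} :=
  HB.pack density_measure
   (isMeasure.Build _ _ _ density_measure nu0 nu_ge0 nu_sigma_additive).

End density.

(** * Reflection invariance of the planar normal law *)

Section normal_plane.
Context {R : realType} (sigma : R) (s0 : sigma != 0).
Local Notation mu := (@lebesgue_measure R).
Local Notation R2 := (measurableTypeR R * measurableTypeR R)%type.
Local Notation N := (normal_prob 0 sigma).
Local Open Scope ereal_scope.

Let psi (x : R2) : \bar R := (normal_pdf 0 sigma x.1 * normal_pdf 0 sigma x.2)%:E.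

Let mpsi : measurable_fun setT psi.
Proof.
apply/measurable_EFinP; apply: measurable_funM.
  by apply: (measurableT_comp (measurable_normal_pdf 0 sigma)).
by apply: (measurableT_comp (measurable_normal_pdf 0 sigma)).
Qed.

Let psi0 x : 0 <= psi x.
Proof. by rewrite lee_fin mulr_ge0// normal_pdf_ge0. Qed.

(** By uniqueness of the product measure it suffices to treat rectangles, where Tonelli factors the
    integral. *)
Lemma normal_prod_density (A : set R2) : measurable A ->
  (N \x N) A = \int[(mu \x mu)]_(x in A) psi x.
Proof.
move=> mA.
rewrite -[RHS]/(density (mu \x mu) mpsi psi0 A).
apply: product_measure_unique => //= B C mB mC.
rewrite /density_measure integral_mkcond fubini_tonelli1//=; last 2 first.
- apply/(measurable_restrictT _ _).1; first exact: measurableX.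
  exact: measurable_funTS.
- by move=> x; rewrite patchE; case: ifP.
rewrite /fubini_F /=.
have h x y : (psi \_ (B `*` C)) (x, y) =
  (EFin \o normal_pdf 0 sigma) \_ B x * (EFin \o normal_pdf 0 sigma) \_ C y.
  rewrite !patchE in_setX /psi/=.
  by case: (x \in B); case: (y \in C); rewrite ?mule0 ?mul0e//= EFinM.
have mn D : measurable D -> measurable_fun setT ((EFin \o normal_pdf 0 sigma) \_ D).
  move=> mD; apply/(measurable_restrictT _ _).1 => //.
  apply: measurable_funTS; apply/measurable_EFinP; exact: measurable_normal_pdf.
have n0 D x : 0 <= ((EFin \o normal_pdf 0 sigma) \_ D) x.
  by rewrite patchE; case: ifP => // _; rewrite lee_fin normal_pdf_ge0.
transitivity (\int[mu]_x (((EFin \o normal_pdf 0 sigma) \_ B) x * N C)).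
  apply: eq_integral => x _; under eq_integral do rewrite h.
  by rewrite ge0_integralZl//; [rewrite -integral_mkcond|exact: mn].
rewrite ge0_integralZr//=; [|exact: mn].
by rewrite -integral_mkcond.
Qed.

Lemma normal_prod_reflect2 (a b : R) (A : set R2) : b != 0%R -> measurable A ->
  (N \x N) (reflect2 a b @^-1` A) = (N \x N) A.
Proof.
move=> b0 mA; have [mg ag] := area_preserving_reflect2 a b0.
have mgA : measurable (reflect2 a b @^-1` A).
  by rewrite -[X in measurable X]setTI; exact: mg.
rewrite !normal_prod_density//.
(* The density depends only on the Euclidean norm, which the reflection preserves. *)
have psig : psi = psi \o reflect2 a b.
  apply/funext => -[x y]; rewrite /psi/= !normal_pdfE// /normal_fun.
  congr EFin; rewrite mulrACA [RHS]mulrACA; congr (_ * _)%R; rewrite -!expRD; congr expR.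
  have r0 : (a ^+ 2 + b ^+ 2 != 0)%R.
    by rewrite gt_eqF// ltr_wpDl ?sqr_ge0// exprn_even_gt0.
  rewrite !subr0 -!mulrDl -!opprD; congr (- _ / _)%R.
  field; exact: r0.
transitivity (\int[pushforward_measure (mu \x mu) mg]_(x in A) psi x).
  rewrite [RHS](ge0_integral_pushforward mg)//; last exact: measurable_funTS.
  by apply: eq_integral => x _; rewrite {1}psig.
apply: eq_measure_integral => B mB _; exact: ag.
Qed.
End normal_plane.

(** * Product laws on tuples, characterised by their values on boxes *)

Section tuple_product.
Context {R : realType} (n : nat).
Local Notation RT := (measurableTypeR R).
Local Notation V := (n.-tuple RT).

Definition box (B : 'I_n -> set RT) : set V := [set t | forall k, B k (tnth t k)].

Lemma measurable_box (B : 'I_n -> set RT) :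
  (forall k, measurable (B k)) -> measurable (box B).
Proof.
move=> mB; have -> : box B = \bigcap_(k in [set: 'I_n]) ((@tnth _ RT ^~ k) @^-1` B k).
  by apply/seteqP; split => t /= h k; [move=> _; exact: h|exact: h].
apply: fin_bigcap_measurable; first exact: finite_finset.
by move=> k _; rewrite -[X in measurable X]setTI; exact: measurable_tnth.
Qed.

(** The sigma-algebra on tuples is generated by preimages under coordinates, and each of these is a
    box with all sides but one equal to [setT]. *)
Lemma measurable_boxE :
  (measurable : set (set V)) =
  <<s [set A | exists B, (forall k, measurable (B k)) /\ A = box B] >>.
Proof.
apply/seteqP; split; last first.
  apply: smallest_sub; first exact: sigma_algebra_measurable.
  by move=> _ [B [mB ->]]; exact: measurable_box.
apply: smallest_sub; first exact: smallest_sigma_algebra.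
move=> A; rewrite -bigcup_seq => -[i _ [C mC <-]].
apply: sub_sigma_algebra; exists (fun k => if k == i then C else setT); split.
  by move=> k; case: ifP.
rewrite setTI; apply/seteqP; split => t /=.
  by move=> Ct k; case: eqP => // ->.
by move=> /(_ i); rewrite eqxx.
Qed.

(** Boxes are stable under intersection and generate the sigma-algebra. *)
Lemma measure_box_unique (m1 m2 : {measure set V -> \bar R}) :
  (forall B, (forall k, measurable (B k)) -> m1 (box B) = m2 (box B)) ->
  (m1 setT < +oo)%E ->
  forall A, measurable A -> m1 A = m2 A.
Proof.
move=> h m1oo A mA.
have boxT : box (fun=> setT) = setT by apply/seteqP; split.
apply: (measure_unique _ (fun=> setT) measurable_boxE) => //.
- move=> _ _ [B [mB ->]] [C [mC ->]]; exists (fun k => B k `&` C k); split.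
    by move=> k; exact: measurableI.
  apply/seteqP; split => t /=; first by move=> [? ?] k; split.
  by move=> h'; split => k; have [] := h' k.
- by move=> _; exists (fun=> setT); split => //; rewrite boxT.
- by rewrite bigcup_const.
- by move=> _ [B [mB ->]]; exact: h.
Qed.

Context (nu : probability RT R) (mu : {measure set V -> \bar R}).
Hypothesis mu_box : forall B, (forall k, measurable (B k)) ->
  mu (box B) = (\prod_k nu (B k))%E.

Lemma mu_setT : mu setT = 1%E.
Proof.
have -> : setT = box (fun=> setT) by apply/seteqP; split.
by rewrite mu_box// big1// => k _; exact: probability_setT.
Qed.

(** With [B] fixed, both sides are finite measures in [D], and on rectangles the equality is the box
    formula. It makes planar sets that are not rectangles accessible. *)
Lemma mu_split_pair (i j : 'I_n) (B : 'I_n -> set RT) (D : set (RT * RT)) :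
  i != j -> (forall k, measurable (B k)) -> measurable D ->
  mu [set t | D (tnth t i, tnth t j) /\
              forall k, k != i -> k != j -> B k (tnth t k)] =
  ((nu \x nu) D * \prod_(k | (k != i) && (k != j)) nu (B k))%E.
Proof.
move=> ij mB mD.
pose others := box (fun k => if (k != i) && (k != j) then B k else setT).
have mo : measurable others by apply: measurable_box => k; case: ifP.
pose pr (t : V) := (tnth t i, tnth t j) : RT * RT.
have mpr : measurable_fun setT pr.
  by apply/measurable_fun_pair; exact: measurable_tnth.
(* The product as a nonnegative real, so that the right-hand side becomes a scaled measure. *)
pose c := \prod_(k | (k != i) && (k != j)) fine (nu (B k)).
have c0 : 0 <= c by apply: prodr_ge0 => k _; exact: fine_ge0.
have cE : (\prod_(k | (k != i) && (k != j)) nu (B k))%E = c%:E.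
  by rewrite /c -prodEFin; apply: eq_bigr => k _; rewrite fineK// fin_num_measure.
have -> : [set t | D (tnth t i, tnth t j) /\
    forall k, k != i -> k != j -> B k (tnth t k)] = pr @^-1` D `&` others.
  apply/seteqP; split => t /= [? h]; split=> // k; last first.
    by move=> ki kj; have := h k; rewrite ki kj.
  by case: ifP => // /andP[]; exact: h.
rewrite cE muleC.
rewrite -[LHS]/(pushforward_measure (mrestr mu mo) mpr D).
rewrite -[RHS]/(mscale (NngNum c0) (nu \x nu)%E D).
pose G : set (set (RT * RT)) :=
  [set C | exists A, measurable A /\ exists B, measurable B /\ C = A `*` B].
apply: (measure_unique G (fun=> setT)) => //.
- rewrite measurable_prod_measurableType //; congr (<<s _ >>).
  rewrite predeqE; split => [[A mA [C mC <-]]|[A [mA [C [mC ->]]]]].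
    by exists A; split => //; exists C.
  by exists A => //; exists C.
- move=> /= _ _ [X1 [mX1 [X2 [mX2 ->]]]] [Y1 [mY1 [Y2 [mY2 ->]]]].
  rewrite -setXI; exists (X1 `&` Y1); split; first exact: measurableI.
  by exists (X2 `&` Y2); split => //; exact: measurableI.
- move=> _; exists setT; split => //; exists setT; split => //.
  by rewrite setXTT.
- by rewrite bigcup_const.
- move=> _ [A [mA [C [mC ->]]]].
  rewrite /mscale /pushforward_measure/= /mrestr /pushforward/=.
  rewrite [X in _ = (_ * X)%E]product_measure1E//.
  have -> : pr @^-1` (A `*` C) `&` others =
      box (fun k => if k == i then A else if k == j then C else B k).
    apply/seteqP; split => t /=.
      move=> [[At Ct] h] k; move: (h k).
      by have [->//|ki] := eqVneq k i; have [->//|kj] := eqVneq k j.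
    move=> h; split.
      split; first by have := h i; rewrite eqxx.
      by have := h j; rewrite eqxx eq_sym (negPf ij).
    by move=> k; have := h k; case: eqP => //; case: eqP.
  rewrite mu_box; last by move=> k; do 2 case: ifP => //.
  rewrite (bigD1 i)//= eqxx (bigD1 j)/=; last by rewrite eq_sym.
  rewrite eqxx eq_sym (negPf ij) muleA [RHS]muleC -cE; congr (_ * _)%E.
  by apply: eq_bigr => k /andP[/negPf -> /negPf ->].
- move=> _; rewrite /pushforward_measure/= /mrestr /pushforward/=.
  rewrite preimage_setT setTI (le_lt_trans (le_measure mu _ _ (@subsetT _ _)))//= ?inE//.
  by rewrite mu_setT ltry.
Qed.

Definition upd2 (i j : 'I_n) (g : RT * RT -> RT * RT) (t : V) : V :=
  [tuple if k == i then (g (tnth t i, tnth t j)).1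
         else if k == j then (g (tnth t i, tnth t j)).2 else tnth t k | k < n].

Lemma measurable_upd2 i j g : measurable_fun setT g ->
  measurable_fun setT (upd2 i j g).
Proof.
move=> mg; apply/measurable_fun_tnthP => k.
have mp : measurable_fun setT (fun t : V => (tnth t i, tnth t j) : RT * RT).
  by apply/measurable_fun_pair; exact: measurable_tnth.
rewrite (_ : _ \o _ = fun t : V => if k == i then (g (tnth t i, tnth t j)).1
    else if k == j then (g (tnth t i, tnth t j)).2 else tnth t k); last first.
  by apply/funext => t; rewrite /= /upd2 tnth_mktuple.
have [_|_] := eqVneq k i.
  exact: (measurableT_comp measurable_fst (measurableT_comp mg mp)).
have [_|_] := eqVneq k j.
  exact: (measurableT_comp measurable_snd (measurableT_comp mg mp)).
exact: measurable_tnth.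
Qed.

(** The preimage of a box restricts the pair [(i, j)] to a planar set and every other coordinate
    separately, so [mu_split_pair] evaluates it. *)
Lemma mu_upd2 i j g : i != j -> measurable_fun setT g ->
  (forall D, measurable D -> (nu \x nu)%E (g @^-1` D) = (nu \x nu)%E D) ->
  forall A, measurable A -> mu (upd2 i j g @^-1` A) = mu A.
Proof.
move=> ij mg gnu A mA.
rewrite -[LHS]/(pushforward_measure mu (measurable_upd2 i j mg) A).
apply: measure_box_unique => // [B mB|]; last first.
  by rewrite /pushforward_measure/= /pushforward preimage_setT mu_setT ltry.
rewrite /pushforward_measure/= /pushforward.
have mgB : measurable (g @^-1` (B i `*` B j)).
  by rewrite -[X in measurable X]setTI; apply: mg => //; exact: measurableX.
have -> : upd2 i j g @^-1` box B =
  [set t | (g @^-1` (B i `*` B j)) (tnth t i, tnth t j) /\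
              forall k, k != i -> k != j -> B k (tnth t k)].
  apply/seteqP; split => t /=.
    move=> h; split.
      split; first by have := h i; rewrite tnth_mktuple eqxx.
      by have := h j; rewrite tnth_mktuple eqxx eq_sym (negPf ij).
    by move=> k ki kj; have := h k; rewrite tnth_mktuple (negPf ki) (negPf kj).
  move=> [[Bi Bj] h] k; rewrite tnth_mktuple.
  by have [->//|ki] := eqVneq k i; have [->//|kj] := eqVneq k j; exact: h.
rewrite mu_split_pair// gnu; last exact: measurableX.
rewrite [X in (X * _)%E]product_measure1E// mu_box//.
rewrite [RHS](bigD1 i)//= [in RHS](bigD1 j)/=; last by rewrite eq_sym.
by rewrite muleA.
Qed.

End tuple_product.

(** * Algebra of Householder reflections *)

Section householder.
Context {R : realType} (n : nat).
Implicit Types u v w x : 'I_n -> R.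

Definition dot u v := \sum_k u k * v k.

(* For [w = 0] the junk value [0^-1 = 0] makes this the identity. *)
Definition householder w v : 'I_n -> R :=
  fun k => v k - 2 * dot w v / dot w w * w k.

Lemma dotC u v : dot u v = dot v u.
Proof. by apply: eq_bigr => k _; rewrite mulrC. Qed.

Lemma dotDZr u v c x : dot u (fun k => v k + c * x k) = dot u v + c * dot u x.
Proof.
by rewrite /dot mulr_sumr -big_split/=; apply: eq_bigr => k _; rewrite mulrDr mulrCA.
Qed.

Lemma dotBr u v x : dot u (fun k => v k - x k) = dot u v - dot u x.
Proof.
by rewrite /dot -sumrB; apply: eq_bigr => k _; rewrite mulrBr.
Qed.

Lemma dotBl u v x : dot (fun k => v k - x k) u = dot v u - dot x u.
Proof. by rewrite dotC dotBr dotC (dotC u x). Qed.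

Lemma dot_eq0 u : dot u u = 0 -> forall k, u k = 0.
Proof.
move=> /eqP; rewrite psumr_eq0/=; last by move=> k _; rewrite -expr2 sqr_ge0.
by move=> /allP h k; apply/eqP; have := h k (mem_index_enum k); rewrite mulf_eq0 orbb.
Qed.

Lemma dot_householderr w u v :
  dot u (householder w v) = dot u v - 2 * dot w v / dot w w * dot u w.
Proof.
rewrite /householder -mulNr -dotDZr; congr dot.
by apply/funext => k; rewrite mulNr.
Qed.

Lemma dot_householderC w u v : dot (householder w u) v = dot u (householder w v).
Proof.
rewrite dotC !dot_householderr (dotC v u) (dotC v w) (dotC u w).
by congr (_ - _); rewrite mulrAC [RHS]mulrAC; congr (_ * _); rewrite mulrAC.
Qed.

Lemma householderK w : involutive (householder w).
Proof.
move=> v; apply/funext => k; rewrite {1}/householder dot_householderr.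
have [w0|w0] := eqVneq (dot w w) 0.
  by rewrite w0 invr0 !(mulr0, mul0r) subr0 /householder w0 invr0 !(mulr0, mul0r) subr0.
by rewrite /householder; field.
Qed.

Lemma dot_householder w u v : dot (householder w u) (householder w v) = dot u v.
Proof. by rewrite dot_householderC householderK. Qed.

Lemma householderDZ w c u v :
  householder w (fun k => u k + c * v k) =
  (fun k => householder w u k + c * householder w v k).
Proof. by apply/funext => k; rewrite /householder dotDZr; ring. Qed.

(** Conjugating a reflection by an isometry moves its normal vector by that isometry. *)
Lemma householder_conj v w x :
  householder v (householder w (householder v x)) = householder (householder v w) x.
Proof.
have -> : householder w (householder v x) =
  fun k => householder v x k + (- (2 * dot w (householder v x) / dot w w)) * w k.
  by apply/funext => k; rewrite mulNr.
rewrite householderDZ householderK; apply/funext => k.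
by rewrite -dot_householderC [in RHS]/householder dot_householder mulNr.
Qed.

(** For vectors of equal norm, the hyperplane orthogonal to [u - v] bisects them. *)
Lemma householder_swap u v : dot u u = dot v v ->
  householder (fun k => u k - v k) u = v.
Proof.
move=> uv; have h : dot (fun k => u k - v k) (fun k => u k - v k) = 2 * (dot u u - dot u v).
  by rewrite dotBr !dotBl -uv (dotC v u); ring.
have h' : dot (fun k => u k - v k) u = dot u u - dot u v.
  by rewrite dotBl (dotC v u).
apply/funext => k; rewrite /householder h h'.
(* In the degenerate case [u - v] has norm zero, so [u] and [v] coincide and the reflection is the
   identity. *)
have [e|e] := eqVneq (dot u u - dot u v) 0; last by field.
have /(_ k)/= := dot_eq0 (etrans h (etrans (congr1 _ e) (mulr0 2))).
by rewrite e !(mulr0,mul0r) subr0; lra.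
Qed.

Lemma householder_orth w v : dot w v = 0 -> householder w v = v.
Proof. by move=> wv; apply/funext => k; rewrite /householder wv !(mulr0,mul0r) subr0. Qed.

End householder.

(** * Reflection invariance of the normal law in dimension [n] *)

Section gaussian.
Context {R : realType} (n : nat) (n1 : (1 < n)%N) (sigma : R) (s0 : sigma != 0).
Local Notation RT := (measurableTypeR R).
Local Notation V := (n.-tuple RT).
Local Notation N := (normal_prob 0 sigma).
Context (mu : {measure set V -> \bar R}).
Hypothesis mu_box : forall B, (forall k, measurable (B k)) ->
  mu (box B) = (\prod_k N (B k))%E.

Definition householder_tuple (w : 'I_n -> R) (t : V) : V :=
  [tuple householder w (tnth t) k | k < n].

Lemma tnth_householder w t : tnth (householder_tuple w t) = householder w (tnth t).
Proof. by apply/funext => k; rewrite tnth_mktuple. Qed.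

Lemma measurable_dot u : measurable_fun setT (fun t : V => dot u (tnth t) : RT).
Proof.
apply: measurable_sum => k; apply: measurable_funM => //; exact: measurable_tnth.
Qed.

Lemma measurable_householder w : measurable_fun setT (householder_tuple w).
Proof.
apply/measurable_fun_tnthP => k.
rewrite (_ : _ \o _ = fun t : V => householder w (tnth t) k); last first.
  by apply/funext => t /=; rewrite tnth_householder.
apply: measurable_funB; first exact: measurable_tnth.
apply: measurable_funM => //; apply: measurable_funM => //; apply: measurable_funM => //.
exact: measurable_dot.
Qed.

Lemma measurable_preimage_householder w A : measurable A ->
  measurable (householder_tuple w @^-1` A).
Proof.
by move=> mA; rewrite -[X in measurable X]setTI; exact: measurable_householder.
Qed.

Let preserved w := forall A, measurable A -> mu (householder_tuple w @^-1` A) = mu A.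

(** Such a reflection acts only on the coordinates [i] and [j], as [reflect2]; [w j != 0] is what
    the shear factorisation divides by. *)
Let preserved_pair (i j : 'I_n) w : i != j -> w j != 0 ->
  (forall k, k != i -> k != j -> w k = 0) -> preserved w.
Proof.
move=> ij wj wk A mA.
have hE (v : 'I_n -> R) : dot w v = w i * v i + w j * v j.
  rewrite /dot (bigD1 i)//= (bigD1 j)/=; last by rewrite eq_sym.
  by rewrite big1 ?addr0// => k /andP[ki kj]; rewrite wk ?mul0r.
have -> : householder_tuple w = upd2 i j (reflect2 (w i) (w j)).
  apply/funext => t; apply: eq_from_tnth => k; rewrite !tnth_mktuple.
  rewrite /householder !hE /reflect2 -!expr2/=.
  have [->//|ki] := eqVneq k i; have [->//|kj] := eqVneq k j.
  by rewrite (wk k)// mulr0 subr0.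
apply: (mu_upd2 mu_box) => //; first by have [] := area_preserving_reflect2 (w i) wj.
by move=> D mD; exact: normal_prod_reflect2.
Qed.

(* Conjugating by a reflection of a coordinate plane that sends [w] to a vector
   with one more zero coordinate. *)
Lemma mu_householder w A : measurable A -> mu (householder_tuple w @^-1` A) = mu A.
Proof.
(* Induction on the number of nonzero coordinates of the normal vector. *)
suff H m (u : 'I_n -> R) : (#|[pred k | u k != 0%R]| <= m)%N -> preserved u.
  exact: (H _ _ (leqnn _)).
elim: m u => [|m IH] u um.
  move=> {}A mA; congr (mu _).
  have -> : householder_tuple u = id; last by [].
  apply/funext => t; apply: eq_from_tnth => k; rewrite tnth_householder /householder.
  move: um; rewrite leqn0 => /eqP/card0_eq/(_ k); rewrite !inE => /negbFE/eqP ->.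
  by rewrite mulr0 subr0.
have [[j uj]|] := pselect (exists j, u j != 0); last first.
  move=> nu; apply: IH; rewrite eq_card0// => k; rewrite !inE.
  by apply/negP => /negP uk; apply: nu; exists k.
have [[i [ij ui]]|] := pselect (exists i, i != j /\ u i != 0); last first.
  move=> nu.
  (* With one nonzero coordinate [j], any other index completes a coordinate plane; one exists
     because [1 < n]. *)
  have [i ij] : exists i, i != j.
    have : (0 < #|predC1 j|)%N by rewrite cardC1 card_ord -ltnS prednK// ltnW.
    by case/card_gt0P => i; rewrite inE; exists i.
  apply: (preserved_pair ij) => // k ki kj.
  by apply/eqP/negPn/negP => uk; apply: nu; exists k.
(* In the plane of [i] and [j], the vector [v] below is [(u i, u j) - (0, rho)], a difference of
   vectors of equal length; reflecting along it sends [u i] to zero. *)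
pose rho := Num.sqrt (u i ^+ 2 + u j ^+ 2).
have rho2 : rho ^+ 2 = u i ^+ 2 + u j ^+ 2 by rewrite sqr_sqrtr// addr_ge0// sqr_ge0.
have ui2 : 0 < u i ^+ 2 by rewrite exprn_even_gt0.
have rhoj : u j - rho != 0.
  by apply/negP => /eqP/subr0_eq e; move: rho2; rewrite -e; lra.
have rho0 : rho != 0.
  by apply/negP => /eqP e; move: rho2; rewrite e; have := sqr_ge0 (u j); lra.
pose v k := if k == i then u i else if k == j then u j - rho else 0.
have vj : v j = u j - rho by rewrite /v eq_sym (negPf ij) eqxx.
have vi : v i = u i by rewrite /v eqxx.
have vk k : k != i -> k != j -> v k = 0 by rewrite /v => /negPf -> /negPf ->.
have hE (x : 'I_n -> R) : dot v x = v i * x i + v j * x j.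
  rewrite /dot (bigD1 i)//= (bigD1 j)/=; last by rewrite eq_sym.
  by rewrite big1 ?addr0// => k /andP[ki kj]; rewrite vk ?mul0r.
have Hvu : householder v u = fun k => u k - v k.
  apply/funext => k; rewrite /householder; congr (_ - _); rewrite -[RHS]mul1r; congr (_ * _).
  have hvv : dot v v = 2 * dot v u.
    by rewrite !hE vi vj; nra.
  have hvu : dot v u = rho * (rho - u j) by rewrite hE vi vj; nra.
  rewrite hvv divff// hvu !mulf_neq0// ?pnatr_eq0//.
  by rewrite -opprB oppr_eq0.
have pv : preserved v by apply: (preserved_pair ij); rewrite ?vj.
have pvu : preserved (householder v u).
  apply: IH; rewrite -ltnS; apply: leq_trans um; apply: proper_card.
  apply/properP; split.
    apply/fintype.subsetP => k; rewrite !inE Hvu.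
    have [->|ki] := eqVneq k i; first by rewrite vi subrr eqxx.
    by have [->//|kj] := eqVneq k j; rewrite vk// subr0.
  by exists i; rewrite !inE ?ui// Hvu vi subrr eqxx.
move=> {}A mA.
have -> : householder_tuple u =
    householder_tuple v \o householder_tuple (householder v u) \o householder_tuple v.
  apply/funext => t; apply: eq_from_tnth => k.
  by rewrite /= !tnth_householder householder_conj householderK.
rewrite comp_preimage pv; last first.
  by rewrite comp_preimage; do 2 apply: measurable_preimage_householder.
by rewrite comp_preimage pvu ?pv//; exact: measurable_preimage_householder.
Qed.

(** A reflection carries [u] to a basis vector [e], and [dot e] is a single coordinate, whose law is
    [N]. *)
Lemma mu_dot_unit u (C : set RT) : dot u u = 1 -> measurable C ->
  mu [set t | C (dot u (tnth t))] = N C.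
Proof.
move=> u1 mC.
pose i : 'I_n := Ordinal (ltnW n1).
pose e (k : 'I_n) : R := (k == i)%:R.
have de v : dot e v = v i.
  rewrite /dot (bigD1 i)//= big1 => [|k /negPf ki]; rewrite /e ?ki ?mul0r//.
  by rewrite eqxx mul1r addr0.
have mE : measurable [set t : V | C (dot e (tnth t))].
  by rewrite -[X in measurable X]setTI; exact: measurable_dot.
transitivity (mu [set t : V | C (dot e (tnth t))]).
  rewrite -[RHS](mu_householder (fun k => e k - u k))//; congr (mu _).
  apply/seteqP; split => t /=;
    by rewrite tnth_householder -dot_householderC householder_swap// de u1 /e eqxx.
have -> : [set t : V | C (dot e (tnth t))] = box (fun k => if k == i then C else setT).
  apply/seteqP; split => t /=; rewrite de.
    by move=> h k; case: eqP => // ->.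
  by move=> /(_ i); rewrite eqxx.
rewrite mu_box; last by move=> k; case: ifP.
rewrite (bigD1 i)//= big1 ?mule1 ?eqxx// => k /negPf ->; exact: probability_setT.
Qed.

(** After normalising [w], this is the mass of a single point under a normal law, which has a
    density. *)
Lemma mu_dot_null w : dot w w != 0 -> mu [set t | dot w (tnth t) = 0] = 0%E.
Proof.
move=> w0.
have wp : 0 < dot w w.
  by rewrite lt_neqAle eq_sym w0 sumr_ge0// => k _; rewrite -expr2 sqr_ge0.
pose r := Num.sqrt (dot w w).
have r0 : r != 0 by rewrite sqrtr_eq0 -ltNge.
pose u k := r^-1 * w k.
have ud v : dot u v = r^-1 * dot w v.
  by rewrite /dot mulr_sumr; apply: eq_bigr => k _; rewrite mulrA.
have u1 : dot u u = 1.
  have e : dot w w = r ^+ 2 by rewrite sqr_sqrtr ?ltW.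
  by rewrite ud dotC ud e; field.
have -> : [set t : V | dot w (tnth t) = 0] = [set t | [set 0 : RT] (dot u (tnth t))].
  apply/seteqP; split => t /=; rewrite ud; first by move=> ->; rewrite mulr0.
  by move/eqP; rewrite mulf_eq0 invr_eq0 (negPf r0) => /eqP.
rewrite mu_dot_unit//.
have := normal_prob_dominates 0 sigma.
move/null_content_dominatesP; apply => //; exact: lebesgue_measure_set1.
Qed.

End gaussian.

(** * Measurability of sets defined by comparing two functions *)

Section measurable_comparison.
Context d (T : measurableType d) (R : realType).

Lemma measurable_eq_fun (f g : T -> measurableTypeR R) :
  measurable_fun setT f -> measurable_fun setT g ->
  measurable [set t | f t = g t].
Proof.
move=> mf mg; rewrite (_ : [set t | f t = g t] = (fun t => f t == g t) @^-1` [set true]).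
  by rewrite -[X in measurable X]setTI; apply: (measurable_fun_eqr mf mg).
by apply/seteqP; split => t /=; [move=> ->; rewrite eqxx|move=> /eqP].
Qed.

Lemma measurable_lt_fun (f g : T -> measurableTypeR R) :
  measurable_fun setT f -> measurable_fun setT g ->
  measurable [set t | f t < g t].
Proof.
move=> mf mg; rewrite (_ : [set t | f t < g t] = (fun t => f t < g t) @^-1` [set true]) //.
by rewrite -[X in measurable X]setTI; apply: (measurable_fun_ltr mf mg).
Qed.

End measurable_comparison.

(** * Equiprobability of the signed dominance events *)

Section orthonormal_family.
Context {R : realType} (n : nat) (n1 : (1 < n)%N) (sigma : R) (s0 : sigma != 0).
Local Notation RT := (measurableTypeR R).
Local Notation V := (n.-tuple RT).
Local Notation N := (normal_prob 0 sigma).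
Context (mu : {measure set V -> \bar R}).
Hypothesis mu_box : forall B, (forall k, measurable (B k)) ->
  mu (box B) = (\prod_k N (B k))%E.
Context (p : nat) (p1 : (1 < p)%N) (x : 'I_p -> 'I_n -> R).
Hypothesis x_orthonormal : forall j k, dot (x j) (x k) = (j == k)%:R.

Let W (k : 'I_p) (t : V) : RT := dot (x k) (tnth t).

Let measurable_W k : measurable_fun setT (W k).
Proof. exact: measurable_dot. Qed.

Definition dominant (j : 'I_p) (b : bool) : set V :=
  [set t | forall k, k != j -> `|W k t| < (-1) ^+ b * W j t].

Definition tie (q : 'I_p * 'I_p * bool) : set V :=
  [set t | W q.1.1 t = (-1) ^+ q.2 * W q.1.2 t].

(** The index condition drops only the trivial identity [W j = W j]. A pair [(j, j)] with sign
    [true] is kept: it says that [W j] vanishes. *)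
Definition ties : set V :=
  \big[setU/set0]_(q | (q.1.1 != q.1.2) || q.2) tie q.

Lemma tiesP t : ties t <-> exists j k b, ((j != k) || b) /\ W j t = (-1) ^+ b * W k t.
Proof.
rewrite /ties -bigcup_seq_cond; split.
  by move=> [[[j k] b]] /andP[_ h] e; exists j, k, b.
by move=> [j [k [b [h e]]]]; exists (j, k, b) => //=; rewrite mem_index_enum.
Qed.

Lemma measurable_tie q : measurable (tie q).
Proof.
apply: measurable_eq_fun; first exact: measurable_W.
by apply: measurable_funM => //; exact: measurable_W.
Qed.

Lemma measurable_ties : measurable ties.
Proof. by apply: bigsetU_measurable => q _; exact: measurable_tie. Qed.

Lemma mu_ties : mu ties = 0%E.
Proof.
apply: measure_negligible; first exact: measurable_ties.
apply: (big_ind (fun A => mu.-negligible A)).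
- exact: negligible_set0.
- by move=> A B; exact: negligibleU.
move=> [[j k] b] /= jkb; apply/negligibleP; first exact: measurable_tie.
pose w i := x j i + - (-1) ^+ b * x k i.
have -> : tie (j, k, b) = [set t | dot w (tnth t) = 0].
  apply/seteqP; split => t /=; rewrite /tie/= dotC dotDZr mulNr !(dotC (tnth t)).
    by move=> /eqP; rewrite -subr_eq0 => /eqP.
  by move=> /eqP; rewrite subr_eq0 => /eqP.
(* The tie is a hyperplane; its normal [w] has squared norm 2 if [j != k], and 4 if [j = k] with
   sign [true]. *)
apply: (mu_dot_null n1 s0 mu_box).
rewrite dotDZr 2!(dotC w) !dotDZr !x_orthonormal !eqxx.
rewrite (eq_sym k j); apply: lt0r_neq0; move: jkb.
by case: (j == k); case: b {w} => //= _; rewrite ?expr1 ?expr0; lra.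
Qed.

Lemma measurable_dominant j b : measurable (dominant j b).
Proof.
have -> : dominant j b = \bigcap_(k in [set k | k != j]) [set t | `|W k t| < (-1) ^+ b * W j t].
  by apply/seteqP; split.
apply: fin_bigcap_measurable; first exact: finite_finset.
move=> k _; apply: measurable_lt_fun; first exact: measurableT_comp (measurable_W k).
by apply: measurable_funM => //; exact: measurable_W.
Qed.

(* The reflection exchanging [x i] with [(-1) ^+ b * x j] fixes the other [x k]. *)
Lemma mu_dominant_eq i j b : mu (dominant j b) = mu (dominant i false).
Proof.
pose v k := (-1) ^+ b * x j k.
pose w k := x i k - v k.
have dv u : dot u v = (-1) ^+ b * dot u (x j).
  by rewrite /dot mulr_sumr; apply: eq_bigr => k _; rewrite /v mulrCA.
have vv : dot (x i) (x i) = dot v v.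
  by rewrite dv dotC dv !x_orthonormal !eqxx mulrA -expr2 sqrr_sign mul1r.
have hi : householder w (x i) = v by exact: householder_swap.
(* The reflection is an involution, so it also sends [v] back to [x i]. *)
have hj : householder w (x j) = fun k => (-1) ^+ b * x i k.
  have e : x j = fun k => 0 + (-1) ^+ b * v k.
    by apply/funext => k; rewrite /v mulrA -expr2 sqrr_sign mul1r add0r.
  rewrite {1}e (householderDZ w _ (fun=> 0)) -hi householderK.
  apply/funext => k; rewrite householder_orth ?add0r//.
  by rewrite /dot big1// => ? _; rewrite mulr0.
have hk k : k != i -> k != j -> householder w (x k) = x k.
  move=> ki kj; apply: householder_orth; rewrite dotC dotBr dv !x_orthonormal.
  by rewrite (negPf ki) (negPf kj) mulr0 subr0.
rewrite -(mu_householder n1 s0 mu_box w (measurable_dominant i false)); congr (mu _).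
have Wi t : W i (householder_tuple w t) = (-1) ^+ b * W j t.
  by rewrite /W tnth_householder -dot_householderC hi dotC dv dotC.
have Wj t : `|W j (householder_tuple w t)| = `|W i t|.
  rewrite /W tnth_householder -dot_householderC hj dotC.
  have -> : (fun k => (-1) ^+ b * x i k) = (fun k => 0 + (-1) ^+ b * x i k).
    by apply/funext => k; rewrite add0r.
  rewrite (dotDZr _ (fun=> 0)) dotC /dot big1; last by move=> *; rewrite mul0r.
  by rewrite add0r normrM normr_sign mul1r -/(dot _ _) dotC.
have Wk k t : k != i -> k != j -> W k (householder_tuple w t) = W k t.
  by move=> ki kj; rewrite /W tnth_householder -dot_householderC hk.
(* The two families of inequalities match up with the indices [i] and [j] exchanged. *)
apply/seteqP; split => t h /= k.
  rewrite Wi expr0 mul1r => ki; have [kj|kj] := eqVneq k j; last by rewrite Wk//; exact: h.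
  by rewrite kj Wj; apply: h; rewrite -kj eq_sym.
move=> kj; rewrite -Wi; have [ki|ki] := eqVneq k i; last first.
  by rewrite -(Wk k)// -[ltRHS]mul1r; exact: h.
by rewrite ki -Wj -[ltRHS]mul1r; apply: h; rewrite -ki eq_sym.
Qed.

(** Two distinct indices cannot each strictly exceed the other in absolute value. For one index,
    both signs would make [W] positive and negative; that the dominant value is positive uses a
    second index, hence [1 < p]. *)
Lemma trivIset_dominant (D : set ('I_p * bool)) :
  trivIset D (fun q => dominant q.1 q.2).
Proof.
have pos q t : dominant q.1 q.2 t -> 0 < (-1) ^+ q.2 * W q.1 t.
  move=> h; have [k kq] : exists k, k != q.1.
    have : (0 < #|predC1 q.1|)%N by rewrite cardC1 card_ord -ltnS prednK// ltnW.
    by case/card_gt0P => k; rewrite inE; exists k.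
  exact: le_lt_trans (h _ kq).
have le (q : 'I_p * bool) t : (-1) ^+ q.2 * W q.1 t <= `|W q.1 t|.
  by rewrite (le_trans (ler_norm _))// normrM normr_sign mul1r.
move=> [j b] [k c] _ _ [t [hq hr]].
have /= jk : j = k.
  apply/eqP/negPn/negP => jk.
  have := hr j jk; rewrite eq_sym in jk; have := hq k jk => /=.
  by have := le (j, b) t; have := le (k, c) t => /=; lra.
have := pos _ _ hq; have := pos _ _ hr; rewrite /= jk => {hq hr}.
move: (W k t) => u {jk}.
by case: b; case: c => //=; rewrite ?expr0 ?expr1 => h1 h2; exfalso; lra.
Qed.

(** An index maximising [|W j t|], with the sign of [W j t], dominates: a second index attaining the
    maximum would be a tie. *)
Lemma dominant_cover t : ~ ties t -> exists j b, dominant j b t.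
Proof.
move=> nt.
pose i0 : 'I_p := Ordinal (ltnW p1).
have [j _ jm] := @Order.TotalTheory.arg_maxP _ R _ i0 xpredT (fun j => `|W j t| : R) isT.
have jmax k : `|W k t| <= `|W j t| by exact: jm.
exists j, (W j t < 0) => k kj.
have -> : (-1) ^+ (W j t < 0)%R * W j t = `|W j t|.
  by rewrite normrEsign.
rewrite lt_neqAle jmax andbT; apply/negP => /eqP e; apply: nt; apply/tiesP.
move/eqP: e; rewrite eqr_norm2 => /orP[] /eqP e.
  by exists k, j, false; rewrite kj expr0 mul1r.
by exists k, j, true; rewrite kj expr1 mulN1r.
Qed.

Lemma mu_dominant j b : mu (dominant j b) = ((2 * p%:R)^-1)%:E.
Proof.
rewrite (mu_dominant_eq j).
pose D := [set` index_enum ('I_p * bool)%type].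
have dD q : D q by rewrite /D /= mem_index_enum.
have fin : finite_set D by exact: finite_finset.
have mS : measurable (\bigcup_(q in D) dominant q.1 q.2).
  by apply: fin_bigcup_measurable => // q _; exact: measurable_dominant.
(* Adjoining the null set [ties] to the union gives the whole space. *)
have : mu (\bigcup_(q in D) dominant q.1 q.2) = 1%E.
  rewrite -(mu_setT mu_box) -(measureU0 mS measurable_ties mu_ties); congr (mu _).
  apply/seteqP; split => // t _; have [Zt|/dominant_cover[k [c kc]]] := pselect (ties t).
    by right.
  by left; exists (k, c).
rewrite measure_fin_bigcup//; last 2 first.
- exact: trivIset_dominant.
- by move=> q _; exact: measurable_dominant.
rewrite /D -fsbig_seq ?index_enum_uniq//.
rewrite (eq_bigr (fun=> mu (dominant j false))) => [|q _]; last exact: mu_dominant_eq.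
have fm : mu (dominant j false) \is a fin_num.
  rewrite ge0_fin_numE//; apply: (@le_lt_trans _ _ (mu setT)).
    by apply: le_measure; rewrite ?inE//; exact: measurable_dominant.
  by rewrite (mu_setT mu_box) ltry.
rewrite -(fineK fm) sumEFin => -[]; rewrite sumr_const card_prod card_ord card_bool.
move=> h; congr EFin; apply: (mulIf (x := 2 * p%:R)).
  by rewrite mulf_neq0// pnatr_eq0// -lt0n ltnW.
rewrite mulVf ?mulf_neq0// ?pnatr_eq0// -?lt0n ?(ltnW p1)//.
by rewrite -natrM mulnC mulr_natr.
Qed.

End orthonormal_family.

(** * Tails of a centred normal law in terms of [Phi] *)

Section normal_tail.
Context {R : realType} (sigma : R) (s0 : 0 < sigma).
Local Notation RT := (measurableTypeR R).
Local Notation mu := (@lebesgue_measure R).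

Lemma normal_prob_opp (A : set RT) : measurable A ->
  normal_prob 0 sigma (-%R @^-1` A) = normal_prob 0 sigma A.
Proof.
move=> mA; have mopp : measurable_fun setT (-%R : RT -> RT) by exact: measurable_funN.
rewrite /normal_prob.
transitivity (\int[pushforward_measure mu mopp]_(x in A) (normal_pdf 0 sigma x)%:E)%E; last first.
  by apply: eq_measure_integral => B mB _; exact: lebesgue_measureN.
rewrite [RHS](ge0_integral_pushforward mopp)//.
- apply: eq_integral => x _ /=; rewrite !normal_pdfE ?gt_eqF// /normal_fun.
  by rewrite !subr0 sqrrN.
- by apply/measurable_funTS/measurable_EFinP; exact: measurable_normal_pdf.
- by move=> x _; rewrite lee_fin normal_pdf_ge0.
Qed.

(** Change of variables by [x -> sigma * x]: the Jacobian [sigma] cancels the [1 / sigma] in the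
    peak of the density. *)
Lemma normal_prob_scale (A : set RT) : measurable A ->
  normal_prob 0 sigma A = normal_prob 0 1 ((fun x => sigma * x) @^-1` A).
Proof.
move=> mA; have msc := measurable_affine sigma 0.
have mpdf m s D : measurable_fun D (fun x : RT => (normal_pdf m s x)%:E).
  by apply/measurable_funTS/measurable_EFinP; exact: measurable_normal_pdf.
rewrite /normal_prob.
transitivity (\int[mscale (NngNum (ltW s0)) (pushforward_measure mu msc)]_(x in A)
    (normal_pdf 0 sigma x)%:E)%E.
  by apply: eq_measure_integral => B mB _; exact: lebesgue_measure_affine.
rewrite ge0_integral_mscale//; last by move=> x _; rewrite lee_fin normal_pdf_ge0.
rewrite [X in (_ * X)%E](ge0_integral_pushforward msc)//; last first.
  by move=> x _; rewrite lee_fin normal_pdf_ge0.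
have -> : (fun x => sigma * x + 0) @^-1` A = (fun x => sigma * x) @^-1` A.
  by apply/seteqP; split => x /=; rewrite addr0.
rewrite -ge0_integralZl//=.
- apply: eq_integral => x _; rewrite -EFinM !normal_pdfE ?gt_eqF ?oner_neq0//.
  rewrite /normal_fun /normal_peak !addr0 !subr0 expr1n mulrA; congr (_ * expR _)%:E.
    rewrite mul1r -mulrnAr sqrtrM ?sqr_ge0// sqrtr_sqr gtr0_norm// invfM mulrA divff ?mul1r//.
    by rewrite gt_eqF.
  by field; rewrite gt_eqF.
- have -> : (fun x => sigma * x) @^-1` A = (fun x => sigma * x + 0) @^-1` A.
    by apply/seteqP; split => x /=; rewrite addr0.
  by rewrite -[X in measurable X]setTI; exact: msc.
- by apply: (measurableT_comp (mpdf _ _ setT)) => //; exact: measurable_funS msc.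
- by move=> x _; rewrite lee_fin normal_pdf_ge0.
- by rewrite lee_fin ltW.
Qed.

(** Symmetry, then scaling. The open half-line obtained differs from the closed one in [Phi] by one
    point, of mass zero. *)
Lemma normal_prob_tail (c : R) :
  normal_prob 0 sigma [set x : RT | - c < x] = (Phi (c / sigma))%:E.
Proof.
have -> : [set x : RT | - c < x] = -%R @^-1` [set x : RT | x < c].
  by apply/seteqP; split => x /=; rewrite ltrNl.
have mc : measurable [set x : RT | x < c].
  by rewrite -set_itvNyo; exact: measurable_itv.
rewrite normal_prob_opp// normal_prob_scale// /Phi fineK; last exact: fin_num_measure.
have -> : (fun x => sigma * x) @^-1` [set x : RT | x < c] = `]-oo, c / sigma[%classic.
  by apply/seteqP; split => x /=; rewrite in_itv/= ltr_pdivlMr// mulrC.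
have -> : `]-oo, (c / sigma)]%classic = `]-oo, (c / sigma)[ `|` [set c / sigma] :> set RT.
  by rewrite setUitv1.
rewrite measureU0//.
move/null_content_dominatesP: (normal_prob_dominates 0 (1:R)); apply => //.
exact: lebesgue_measure_set1.
Qed.
End normal_tail.

(** * Deterministic comparison of the two minimal losses *)

Section lasso.
Context {R : realType} (n p : nat) (n0 : (0 < n)%N) (i0 : 'I_p) (b : R) (z : 'cV[R]_p).
Hypotheses (b0 : b != 0) (sgz : Num.sg (z i0 0) = Num.sg b).

Let a := `|z i0 0|.
Let m := Num.max (a - `|b|) 0.

(** The common sign of [z i0 0] and [b] factors out of the difference and squares to 1. *)
Let L1E l : L1 n i0 b z l = n%:R^-1 * (`|b| - pospart (a - l)) ^+ 2.
Proof.
rewrite /L1 sgz -/a {1}(numEsg b) -mulrBr exprMn sqr_sg b0 mul1r.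
by rewrite mulrC.
Qed.

Let LpE l : Lp n i0 b z l = L1 n i0 b z l +
  n%:R^-1 * \sum_(j < p | j != i0) (pospart (`|z j 0| - l)) ^+ 2.
Proof. by []. Qed.

Let a_gt0 : 0 < a.
Proof. by rewrite normr_gt0 -sgr_eq0 sgz sgr_eq0. Qed.

Let b_gt0 : 0 < `|b|. Proof. by rewrite normr_gt0. Qed.

Let n_gt0 : 0 < n%:R^-1 :> R. Proof. by rewrite invr_gt0 ltr0n. Qed.

Let m_ge0 : 0 <= m. Proof. by rewrite le_max lexx orbT. Qed.

Let pospart_id (x : R) : 0 <= x -> pospart x = x.
Proof. by move=> x0; apply/max_idPl. Qed.

Let am_gt0 : 0 < a - m.
Proof. by rewrite /m subr_gt0 gt_max a_gt0 ltrBlDr ltrDl b_gt0. Qed.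

(** At [m] the shrunken size [a - m] is positive and at most [|b|]; a larger penalty shrinks it
    strictly further from [|b|]. *)
Let L1_argmin l : m < l -> L1 n i0 b z m < L1 n i0 b z l.
Proof.
move=> ml; rewrite !L1E ltr_pM2l// (pospart_id (ltW am_gt0)).
have h1 : 0 <= `|b| - (a - m).
  by have : a - `|b| <= m; [rewrite le_max lexx|lra].
have h2 : pospart (a - l) < a - m by rewrite /pospart gt_max am_gt0; lra.
by rewrite ltr_pXn2r ?nnegrE//; lra.
Qed.

Let L1_min l : 0 <= l -> L1 n i0 b z m <= L1 n i0 b z l.
Proof.
move=> l0; have [lm|/L1_argmin/ltW//] := leP l m.
have [h|h] := leP (a - `|b|) 0.
  have m0 : m = 0 by apply/max_idPr.
  by have -> : l = m by apply/le_anti; rewrite lm m0.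
have mE : m = a - `|b| by apply/max_idPl/ltW.
rewrite !L1E ler_pM2l// (pospart_id (ltW am_gt0)) mE.
have -> : `|b| - (a - (a - `|b|)) = 0 by ring.
by rewrite expr0n/= sqr_ge0.
Qed.

(** The loss is continuous, and constant once the penalty exceeds every [|z j 0|], so the extreme
    value theorem on a compact interval suffices. *)
Let Lp_argmin : exists2 lp, 0 <= lp & forall l, 0 <= l -> Lp n i0 b z lp <= Lp n i0 b z l.
Proof.
pose M := \sum_j `|z j 0|.
have zM j : `|z j 0| <= M.
  by rewrite /M (bigD1 j)//= lerDl sumr_ge0.
have M0 : 0 <= M by exact: sumr_ge0.
have cpos : continuous (pospart : R -> R).
  move=> l; apply: (@continuous_max _ _ (id : R -> R^o) (cst 0 : R -> R^o)).
    exact: cvg_id.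
  exact: cvg_cst.
have cposB (c l : R) : pospart (c - x) @[x --> l] --> pospart (c - l).
  apply: (continuous_comp (f := fun x => c - x)); last exact: cpos.
  by apply: cvgB; [exact: cvg_cst|exact: cvg_id].
have csqr (f : R -> R) l : f x @[x --> l] --> f l -> f x ^+ 2 @[x --> l] --> f l ^+ 2.
  by move=> cf; rewrite !expr2; under eq_fun do rewrite expr2; exact: cvgM.
have cL : continuous (Lp n i0 b z).
  move=> l; apply: cvgD.
    apply: cvgM; first exact: cvg_cst.
    apply: csqr; apply: cvgB; first exact: cvg_cst.
    by apply: cvgM; [exact: cvg_cst|exact: cposB].
  apply: cvgM; first exact: cvg_cst.
  by apply: cvg_big => [|j _]; [exact: add_continuous|apply: csqr; exact: cposB].
have [lp lpM lpmin] := EVT_min M0 (continuous_subspaceT cL).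
exists lp; first by move: lpM; rewrite in_itv/= => /andP[].
move=> l l0; have [lM|Ml] := leP l M; first by apply: lpmin; rewrite in_itv/= l0.
rewrite (@le_trans _ _ (Lp n i0 b z M))//; first by apply: lpmin; rewrite in_itv/= M0 lexx.
have posM j : pospart (`|z j 0| - M) = 0 by apply/max_idPr; rewrite subr_le0.
have posl j : pospart (`|z j 0| - l) = 0.
  by apply/max_idPr; rewrite subr_le0 (le_trans (zM j))// ltW.
rewrite /Lp posM posl.
by rewrite lerD2l ler_pM2l//; apply: ler_sum => j _; rewrite posM posl.
Qed.

(** If every other [|z k 0|] is at most [m], the extra sum vanishes at [m] and the minima agree.
    Otherwise some [k] has [|z k 0| > m], and any penalty either keeps that term positive or
    overshoots [m]. *)
Lemma lasso_loss_gtP :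
  (exists lp l1 : R,
    [/\ 0 <= lp, 0 <= l1,
      (forall l : R, 0 <= l -> Lp n i0 b z lp <= Lp n i0 b z l),
      (forall l : R, 0 <= l -> L1 n i0 b z l1 <= L1 n i0 b z l)
    & L1 n i0 b z l1 < Lp n i0 b z lp]) <->
  ~ (forall k, k != i0 -> `|z k 0| <= Num.max (`|z i0 0| - `|b|) 0).
Proof.
rewrite -/a -/m; split.
  move=> [lp [l1 [lp0 l10 lpmin l1min]]] + small.
  apply/negP; rewrite -leNgt (le_trans (lpmin m m_ge0))//.
  rewrite LpE big1 ?mulr0 ?addr0 ?L1_min// => j ji.
  have -> : pospart (`|z j 0| - m) = 0 by apply/max_idPr; rewrite subr_le0 small.
  by rewrite expr0n.
move=> /existsNP[k /not_implyP[ki /negP]]; rewrite -ltNge => mk.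
have [lp lp0 lpmin] := Lp_argmin.
exists lp, m; split => //.
(* For [lp <= m] the term of index [k] is positive; for [lp > m] the [L1] part alone is already
   strictly above its minimum. *)
rewrite LpE; have [lpm|lpm] := leP lp m.
  rewrite (le_lt_trans (L1_min lp0))// ltrDl mulr_gt0//.
  rewrite (bigD1 k)//= ltr_wpDr ?sumr_ge0// => [j _|]; first exact: sqr_ge0.
  by rewrite exprn_even_gt0//= gt_eqF// /pospart lt_max subr_gt0 (le_lt_trans lpm).
by rewrite ltr_wpDr ?L1_argmin// mulr_ge0 ?(ltW n_gt0)// sumr_ge0// => j _; exact: sqr_ge0.
Qed.
End lasso.

(** * The sign condition in terms of the signed noise *)

Section sign_event.
Context {R : realType} (b : R) (b0 : b != 0).

(** The factor [(-1) ^+ (b < 0)] is the sign of [b]; it turns [b + w] into [|b|] plus the signed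
    noise, which must be positive. *)
Lemma sgr_addE (w : R) :
  (Num.sg (b + w) = Num.sg b) <-> (- `|b| < (-1) ^+ (b < 0)%R * w).
Proof.
case: (ltgtP b 0) b0 => // bn _.
- rewrite (ltr0_sg bn) (ltr0_norm bn) expr1; split.
    by move/eqP; rewrite sgr_cp0; lra.
  by move=> h; apply/eqP; rewrite sgr_cp0; lra.
- rewrite (gtr0_sg bn) (gtr0_norm bn) expr0; split.
    by move/eqP; rewrite sgr_cp0; lra.
  by move=> h; apply/eqP; rewrite sgr_cp0; lra.
Qed.

Lemma norm_add_sub (w : R) : - `|b| < (-1) ^+ (b < 0)%R * w ->
  `|b + w| - `|b| = (-1) ^+ (b < 0)%R * w.
Proof.
case: (ltgtP b 0) b0 => // bn _.
- by rewrite (ltr0_norm bn) expr1 => h; rewrite ltr0_norm; lra.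
- by rewrite (gtr0_norm bn) expr0 => h; rewrite gtr0_norm; lra.
Qed.

End sign_event.

(** * Probabilities of sign recovery and of equal minimal losses *)

Section selection_event.
Context {R : realType} (n : nat) (n1 : (1 < n)%N) (sigma : R) (s0 : 0 < sigma).
Local Notation RT := (measurableTypeR R).
Local Notation V := (n.-tuple RT).
Local Notation N := (normal_prob 0 sigma).
Context (mu : {measure set V -> \bar R}).
Hypothesis mu_box : forall B, (forall k, measurable (B k)) ->
  mu (box B) = (\prod_k N (B k))%E.
Context (p : nat) (p1 : (1 < p)%N) (x : 'I_p -> 'I_n -> R).
Hypothesis x_orthonormal : forall j k, dot (x j) (x k) = (j == k)%:R.
Context (i0 : 'I_p) (b : R) (b0 : b != 0).

Let W (k : 'I_p) (t : V) : RT := dot (x k) (tnth t).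
Let s : bool := b < 0.

Definition sign_recovered : set V := [set t | Num.sg (b + W i0 t) = Num.sg b].

Definition noise_dominated : set V :=
  [set t | forall k, k != i0 -> `|W k t| <= Num.max (`|b + W i0 t| - `|b|) 0].

Lemma sign_recoveredE : sign_recovered = [set t | - `|b| < (-1) ^+ s * W i0 t].
Proof. by apply/seteqP; split => t /= /(sgr_addE b0). Qed.

Lemma measurable_sign_recovered : measurable sign_recovered.
Proof.
rewrite sign_recoveredE; apply: measurable_lt_fun => //.
by apply: measurable_funM => //; exact: measurable_dot.
Qed.

Lemma measurable_noise_dominated : measurable noise_dominated.
Proof.
have -> : noise_dominated = \bigcap_(k in [set k | k != i0])
    ~` [set t | Num.max (`|b + W i0 t| - `|b|) 0 < `|W k t|].
  apply/seteqP; split => t /= h k ki; first by apply/negP; rewrite -leNgt; exact: h.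
  by rewrite leNgt; apply/negP; exact: h.
apply: fin_bigcap_measurable; first exact: finite_finset.
move=> k _; apply: measurableC; apply: measurable_lt_fun.
  apply: measurable_maxr => //; apply: measurable_funB => //.
  apply: (measurableT_comp (f := Num.norm : RT -> RT)) => //.
  by apply: measurable_funD => //; exact: measurable_dot.
by apply: (measurableT_comp (f := Num.norm : RT -> RT)) => //; exact: measurable_dot.
Qed.

(** The signed noise is the product with the unit vector [(-1) ^+ s * x i0], so it has law [N]. *)
Lemma mu_sign_recovered : mu sign_recovered = (Phi (`|b| / sigma))%:E.
Proof.
rewrite -normal_prob_tail// sign_recoveredE.
pose u k := (-1) ^+ s * x i0 k.
have du v : dot u v = (-1) ^+ s * dot (x i0) v.
  by rewrite /dot mulr_sumr; apply: eq_bigr => k _; rewrite mulrA.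
have u1 : dot u u = 1.
  by rewrite du dotC du x_orthonormal eqxx mulrA -expr2 sqrr_sign mul1r.
rewrite -(mu_dot_unit n1 (lt0r_neq0 s0) mu_box u1); last first.
  have -> : [set r : RT | - `|b| < r] = `]- `|b|, +oo[%classic.
    by apply/seteqP; split => r /=; rewrite in_itv/= andbT.
  exact: measurable_itv.
by congr (mu _); apply/seteqP; split => t /=; rewrite du.
Qed.

(** Up to [ties], the event is [dominant i0 s]; adjoining that null set to both turns this into an
    equality of sets. *)
Lemma mu_noise_dominated : mu (sign_recovered `&` noise_dominated) = ((2 * p%:R)^-1)%:E.
Proof.
have s0' := lt0r_neq0 s0.
have mZ := measurable_ties x; have Z0 := mu_ties n1 s0' mu_box x_orthonormal.
rewrite -(mu_dominant n1 s0' mu_box p1 x_orthonormal i0 s).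
rewrite -(measureU0 (measurable_dominant x i0 s) mZ Z0).
rewrite -[LHS](measureU0 _ mZ Z0); last first.
  by apply: measurableI; [exact: measurable_sign_recovered|exact: measurable_noise_dominated].
congr (mu _); apply/seteqP; split => t [|]; try by right.
  rewrite sign_recoveredE => -[/= h dom].
  have [|Z] := pselect (ties x t); first by right.
  left => k ki; move: (dom k ki); rewrite norm_add_sub//.
  have Wk : W k t != 0.
    apply/negP => /eqP Wk; apply: Z; apply/tiesP; exists k, k, true.
    by rewrite orbT -/(W k t) Wk mulr0.
  (* If the signed noise is not positive, the bound is zero and forces [W k t = 0], a tie already
     excluded. *)
  have [Wi|Wi] := leP ((-1) ^+ s * W i0 t) 0.
    by rewrite normr_le0 (negPf Wk).
  rewrite le_eqVlt => /orP[/eqP e|//]; exfalso; apply: Z; apply/tiesP.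
  have {}e : `|W k t| = `|W i0 t|.
    by rewrite e -(gtr0_norm Wi) normrM normr_sign mul1r.
  move/eqP: e; rewrite eqr_norm2 => /orP[] /eqP e.
    by exists k, i0, false; rewrite ki expr0 mul1r.
  by exists k, i0, true; rewrite ki expr1 mulN1r.
move=> dom; left.
(* Positivity, from any second index, gives sign recovery and makes the maximum with 0 equal to the
   signed noise. *)
have Wi : 0 < (-1) ^+ s * W i0 t.
  have [k ki] : exists k, k != i0.
    have : (0 < #|predC1 i0|)%N by rewrite cardC1 card_ord -ltnS prednK// ltnW.
    by case/card_gt0P => k; rewrite inE; exists k.
  exact: le_lt_trans (dom k ki).
have h : - `|b| < (-1) ^+ s * W i0 t by rewrite (le_lt_trans _ Wi)// oppr_le0.
rewrite sign_recoveredE; split => //= k ki.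
by rewrite norm_add_sub// le_max ltW//; exact: dom.
Qed.

End selection_event.

(** * The conditional probability *)

Theorem theorem2p2 (R : realType) (d : measure_display) (T : measurableType d)
  (P : probability T R) (n p : nat) (hp : (1 < p)%N) (hpn : (p <= n)%N)
  (X : 'M[R]_(n, p)) (hX : X^T *m X = 1%:M)
  (beta1 : R) (hbeta1 : beta1 != 0) (sigma : R) (hsigma : 0 < sigma)
  (eps : 'I_n -> {RV P >-> R})
  (heps_ind : mutually_independent P (fun i => (eps i : T -> R)))
  (heps_law : forall (i : 'I_n) (B : set R), measurable B ->
       distribution P (eps i) B = normal_prob 0 sigma B) :
  let i0 : 'I_p := Ordinal (ltnW hp) in
  let beta0 : 'cV[R]_p := \col_(j < p) (if j == i0 then beta1 else 0) in
  let y (w : T) : 'cV[R]_n := X *m beta0 + \col_(i < n) eps i w in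
  let z (w : T) : 'cV[R]_p := X^T *m y w in
  let A := [set w | exists lp l1 : R,
              [/\ 0 <= lp, 0 <= l1,
                  (forall l : R, 0 <= l -> Lp n i0 beta1 (z w) lp <= Lp n i0 beta1 (z w) l),
                  (forall l : R, 0 <= l -> L1 n i0 beta1 (z w) l1 <= L1 n i0 beta1 (z w) l)
                & L1 n i0 beta1 (z w) l1 < Lp n i0 beta1 (z w) lp]] in
  let B := [set w | Num.sg (z w i0 0) = Num.sg beta1] in
  cond_prob P A B = 1 - (2 * p%:R * Phi (`|beta1| / sigma))^-1.
Proof.
move=> i0 beta0 y z A B.
have n1 : (1 < n)%N := leq_trans hp hpn.
pose Y (w : T) : n.-tuple (measurableTypeR R) := [tuple eps i w | i < n].
have tY w : tnth (Y w) = fun i => eps i w by apply/funext => i; rewrite tnth_mktuple.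
have mY : measurable_fun setT Y.
  apply/measurable_fun_tnthP => i.
  rewrite (_ : _ \o _ = eps i); first exact: (@measurable_funPT _ _ _ _ (eps i)).
  by apply/funext => w; rewrite /= tY.
pose mu := pushforward_measure P mY.
have mu_box C : (forall k, measurable (C k)) ->
    mu (box C) = (\prod_k normal_prob 0 sigma (C k))%E.
  move=> mC.
  (* Independence is used for the full index set, where the intersection is the preimage of a
     box. *)
  transitivity (\prod_(i in [set: 'I_n]%SET) P (eps i @^-1` C i))%E; last first.
    by apply: eq_big => [i|i _]; [rewrite finset.in_setT|exact: (heps_law i _ (mC i))].
  rewrite -heps_ind// /mu /pushforward_measure/= /pushforward; congr (P _).
  apply/seteqP; split => w /= h i; first by move=> _ /=; have := h i; rewrite tY.
  by rewrite tY; apply: h; rewrite /= finset.in_setT.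
pose x (k : 'I_p) (i : 'I_n) := X i k.
have x_orthonormal j k : dot (x j) (x k) = (j == k)%:R.
  transitivity ((X^T *m X) j k); last by rewrite hX mxE.
  by rewrite mxE; apply: eq_bigr => i _; rewrite mxE.
(* Since [X^T *m X] is the identity, [z] is [beta0] plus the noise projected on the columns. *)
have zE w k : z w k 0 = (if k == i0 then beta1 else 0) + dot (x k) (tnth (Y w)).
  rewrite /z /y mulmxDr mulmxA hX mul1mx !mxE; congr (_ + _).
  by apply: eq_bigr => i _; rewrite !mxE tY.
have zi0 w : z w i0 0 = beta1 + dot (x i0) (tnth (Y w)) by rewrite zE eqxx.
have BE : B = Y @^-1` sign_recovered x i0 beta1.
  by apply/seteqP; split => w; rewrite /B /sign_recovered /= zi0.
have ABE : A `&` B = Y @^-1` (sign_recovered x i0 beta1 `\` noise_dominated x i0 beta1).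
  have nd w : (forall k, k != i0 ->
      `|z w k 0| <= Num.max (`|z w i0 0| - `|beta1|) 0) <-> noise_dominated x i0 beta1 (Y w).
    rewrite /noise_dominated /= zi0; split => h k ki; have := h k ki.
      by rewrite zE (negPf ki) add0r.
    by rewrite zE (negPf ki) add0r.
  rewrite BE; apply/seteqP; split => w.
    move=> [Aw Bw]; split => // /nd; apply/(lasso_loss_gtP (ltnW n1) hbeta1) => //.
    by rewrite zi0.
  move=> [Bw Cw]; split => //; apply/(lasso_loss_gtP (ltnW n1) hbeta1); first by rewrite zi0.
  by move/nd.
have mE := measurable_sign_recovered x i0 hbeta1.
have mC := measurable_noise_dominated x i0 beta1.
have PB : P B = (Phi (`|beta1| / sigma))%:E.
  by rewrite BE -(mu_sign_recovered n1 hsigma mu_box x_orthonormal i0 hbeta1).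
have EC := mu_noise_dominated n1 hsigma mu_box hp x_orthonormal i0 hbeta1.
have PAB : P (A `&` B) = (Phi (`|beta1| / sigma) - (2 * p%:R)^-1)%:E.
  rewrite ABE EFinB -EC -PB BE; apply: (measureD (mu := mu)) => //.
  by rewrite [ltLHS](mu_sign_recovered n1 hsigma mu_box x_orthonormal i0 hbeta1) ltry.
have p0 : 0 < p%:R :> R by rewrite ltr0n ltnW.
(* The conditioning event contains one of probability [1 / (2p)], so the division is legitimate. *)
have Phi_gt0 : 0 < Phi (`|beta1| / sigma).
  rewrite -lte_fin -PB BE; apply: (@lt_le_trans _ _ (2 * p%:R)^-1%:E).
    by rewrite lte_fin invr_gt0 mulr_gt0.
  rewrite -EC; apply: (le_measure mu); rewrite ?inE//; exact: measurableI.
rewrite /cond_prob PAB PB /=; field.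
by rewrite !gt_eqF.
Qed.
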